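(* Let $n\ge 1$ and consider a contextual $n$-partite game in which every player has binary input choices, so that the contexts are the tuples $x\in\{0,1\}^n$. Let $C\in\{0,1\}^n$ be a distinguished context and let $\sigma\in[0,1]$. Define $$S^{\sigma}_{C} := \max_p\{\, S(p) \;:\; \mathsf{SF}(p)\le\sigma \text{ and there is an output tuple } a \text{ with } p(a|C)=1 \,\},$$ $$S^{\xi}_{\mathrm{cl}} := \max_p\{\, S(p) \;:\; \mathsf{CF}(p)\le \xi \,\},$$ where both maxima range over all behaviours $p$ of the game (signalling or not), $S(p)$ is the score, $\mathsf{SF}$ the signalling fraction and $\mathsf{CF}$ the contextual fraction. Then $$S^{\sigma}_{C}\;\le\; S^{\xi=\sigma}_{\mathrm{cl}}.$$
   Context: Game. There are $n$ players. Player $i$ receives an input $x_i\in\{0,1\}$ and returns an output $a_i$ in a finite nonempty set $A_i$. A context is an input tuple $x=(x_1,\dots,x_n)\in\{0,1\}^n$. The game is specified by a probability distribution $\mu$ on contexts and a scoring function $V:\prod_i A_i\times\{0,1\}^n\to\{0,1\}$. Behaviours. A behaviour $p$ is a family of probability distributions $p(\cdot|x)$ on $\prod_i A_i$, one for each context $x\in\{0,1\}^n$; no further condition is imposed (in particular, a behaviour may be signalling). Convex combinations of behaviours are taken context by context. The score of $p$ is $S(p)=\sum_{x}\sum_{a}\mu(x)V(a,x)p(a|x)$. No-signalling. A behaviour $p$ is no-signalling if for any two contexts $x,x'$ and any subset $I$ of players with $x_i=x'_i$ for all $i\in I$, the marginals of $p(\cdot|x)$ and $p(\cdot|x')$ on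 $(a_i)_{i\in I}$ coincide. Non-contextuality. A global assignment is a tuple $g=(g_{i,t})_{1\le i\le n,\;t\in\{0,1\}}$ with $g_{i,t}\in A_i$. A behaviour $p$ is non-contextual if there is a probability distribution $d$ on global assignments such that, for every context $x$, $p(\cdot|x)$ is the distribution of $(g_{1,x_1},\dots,g_{n,x_n})$ when $g$ is drawn from $d$. Signalling fraction. $\mathsf{SF}(p)=1-s^*$, where $s^*$ is the maximum of $s\in[0,1]$ such that $p=s\,p'+(1-s)\,p''$ for some no-signalling behaviour $p'$ and some behaviour $p''$. Contextual fraction. $\mathsf{CF}(p)=1-s^*$, where $s^*$ is the maximum of $s\in[0,1]$ such that $p=s\,p'+(1-s)\,p''$ for some non-contextual behaviour $p'$ and some behaviour $p''$. *)

(* Defs.v *)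
From HB Require Import structures.
From mathcomp Require Import all_boot all_order all_algebra.
From mathcomp Require Import lra.
From mathcomp Require Import all_classical all_reals all_analysis.

Set Implicit Arguments.
Unset Strict Implicit.
Unset Printing Implicit Defensive.

Import Order.TTheory GRing.Theory Num.Theory.
Import numFieldNormedType.Exports.

Local Open Scope classical_set_scope.
Local Open Scope ring_scope.

Record dist (R : realType) (T : finType) := Dist {
  dist_fun :> T -> R;
  dist_ge0 : forall t, 0 <= dist_fun t;
  dist_sum1 : \sum_t dist_fun t = 1 }.

Notation context n := {ffun 'I_n -> bool}.
Notation outputs A := {dffun forall i, A i}.
(* g (i, t) is the output that player i gives to the input t *)
Notation assignment A := {dffun forall it : 'I__ * bool, A it.1}.

Record game (R : realType) (n : nat) (A : 'I_n -> finType) := Game {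
  game_dist : dist R (context n);
  game_rule : outputs A -> context n -> bool }.

Section Behaviours.
Context {R : realType} {n : nat} {A : 'I_n -> finType}.

Definition behaviour : Type := context n -> dist R (outputs A).

Definition score (G : game R A) (p : behaviour) : R :=
  \sum_x \sum_a game_dist G x * (game_rule G a x)%:R * p x a.

(* The marginal on the players of I, evaluated at the restriction of b to I.
   Every partial output tuple is such a restriction, because the output sets
   are nonempty as soon as there is a probability distribution on outputs. *)
Definition marginal (q : dist R (outputs A)) (I : {set 'I_n}) (b : outputs A)
    : R :=
  \sum_(a : outputs A | [forall i in I, a i == b i]) q a.

Definition no_signalling (p : behaviour) : Prop :=
  forall (x x' : context n) (I : {set 'I_n}),
    (forall i, i \in I -> x i = x' i) ->
    forall b, marginal (p x) I b = marginal (p x') I b.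

Definition answers (g : assignment A) (x : context n) : outputs A :=
  [ffun i => g (i, x i)].

Definition non_contextual (p : behaviour) : Prop :=
  exists d : dist R (assignment A),
    forall x a, p x a = \sum_(g | answers g x == a) d g.

Definition is_mixture (s : R) (p p' p'' : behaviour) : Prop :=
  forall x a, p x a = s * p' x a + (1 - s) * p'' x a.

Definition weights (P : behaviour -> Prop) (p : behaviour) : set R :=
  [set s | 0 <= s <= 1 /\
    exists p' p'' : behaviour, P p' /\ is_mixture s p p' p''].

(* Maxima are written with sup; signalling_fraction_max,
   contextual_fraction_max, det_score_max and cl_score_max
   below show that, for nonempty output sets, the suprema are attained. *)
Definition signalling_fraction (p : behaviour) : R :=
  1 - sup (weights no_signalling p).

Definition contextual_fraction (p : behaviour) : R :=
  1 - sup (weights non_contextual p).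

Definition det_scores (G : game R A) (C : context n) (sigma : R) : set R :=
  [set score G p | p in [set p | signalling_fraction p <= sigma /\
                                 exists a, p C a = 1]].

Definition cl_scores (G : game R A) (xi : R) : set R :=
  [set score G p | p in [set p | contextual_fraction p <= xi]].

Definition det_score (G : game R A) (C : context n) (sigma : R) : R :=
  sup (det_scores G C sigma).

Definition cl_score (G : game R A) (xi : R) : R := sup (cl_scores G xi).

End Behaviours.
Arguments behaviour R {n} A.

Definition is_max {R : realType} (E : set R) (m : R) : Prop :=
  E m /\ ubound E m.

Lemma is_max_sup {R : realType} (E : set R) m : is_max E m -> is_max E (sup E).
Proof.
move=> [Em ubm]; suff -> : sup E = m by [].
apply/eqP; rewrite eq_le ge_sup//=; last by exists m.
by apply: ub_le_sup => //; exists m.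
Qed.

Section Attained.
Context {R : realType}.
Implicit Types T : topologicalType.

Lemma closed_fun_eq T (f g : T -> R) :
  continuous f -> continuous g -> closed [set t | f t = g t].
Proof.
move=> cf cg.
have -> : [set t | f t = g t] = (fun t => f t - g t) @^-1` [set x | x = 0].
  by apply/seteqP; split=> t /= => [->|/eqP]; rewrite ?subrr// subr_eq0 => /eqP.
apply: preimage_closed; last exact: closed_eq.
by move=> t _; apply: cvgB; [exact: cf|exact: cg].
Qed.

Lemma closed_fun_ge T (f : T -> R) (c : R) :
  continuous f -> closed [set t | c <= f t].
Proof.
move=> cf; apply: (@preimage_closed _ _ f [set x | c <= x]); last exact: closed_ge.
by move=> t _; exact: cf.
Qed.

Lemma continuous_sum T (I : finType) (P : pred I) (f : I -> T -> R) :
  (forall i, continuous (f i)) -> continuous (fun t => \sum_(i | P i) f i t).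
Proof. by move=> cf; apply: continuous_big => //; exact: add_continuous. Qed.

Lemma continuous_add T (f g : T -> R) :
  continuous f -> continuous g -> continuous (fun t => f t + g t).
Proof. by move=> cf cg t; apply: cvgD; [exact: cf|exact: cg]. Qed.

Lemma continuous_sub T (f g : T -> R) :
  continuous f -> continuous g -> continuous (fun t => f t - g t).
Proof. by move=> cf cg t; apply: cvgB; [exact: cf|exact: cg]. Qed.

Lemma continuous_mul T (f g : T -> R) :
  continuous f -> continuous g -> continuous (fun t => f t * g t).
Proof. by move=> cf cg t; apply: cvgM; [exact: cf|exact: cg]. Qed.

Lemma continuous_fst T T' : continuous (@fst T T').
Proof. by move=> t; exact: cvg_fst. Qed.

Lemma continuous_snd T T' : continuous (@snd T T').
Proof. by move=> t; exact: cvg_snd. Qed.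


Lemma coord_cont (I : finType) (i : I) :
  continuous (fun f : {ptws I -> R} => f i : R).
Proof. exact: (@proj_continuous I (fun=> R) i). Qed.

Definition raw (J K : finType) (p : J -> dist R K) : {ptws J * K -> R} :=
  fun jk => p jk.1 jk.2.

Lemma dist_le1 (K : finType) (q : dist R K) k : q k <= 1.
Proof.
rewrite -(dist_sum1 q) (bigD1 k)//= lerDl.
by apply: sumr_ge0 => i _; exact: dist_ge0.
Qed.

Lemma raw_surj (J K : finType) (f : J * K -> R) :
  (forall jk, 0 <= f jk) -> (forall j, \sum_k f (j, k) = 1) ->
  exists p : J -> dist R K, raw p = f.
Proof.
move=> f0 f1.
exists (fun j => @Dist R K (fun k => f (j, k)) (fun k => f0 (j, k)) (f1 j)).
by apply/funext => -[j k].
Qed.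

Lemma raw_compact (J K : finType) : compact (range (@raw J K)).
Proof.
pose W : topologicalType := {ptws J * K -> R}.
have cc : compact [set f : W | forall i, `[0, 1]%classic (f i)].
  exact: (@tychonoff (J * K)%type (fun=> R) (fun=> `[0, 1]%classic)
    (fun=> @segment_compact R 0 1)).
pose B : set W := \bigcap_(j in setT) [set f : W | \sum_k f (j, k) = 1].
have cB : closed B.
  apply: closed_bigI => j _.
  apply: (@closed_fun_eq W (fun f => \sum_k f (j, k)) (fun=> 1)).
    by apply: continuous_sum => k; exact: coord_cont.
  exact: cst_continuous.
have := compact_closedI cc cB; congr (compact _).
apply/seteqP; split => [f [f0 f1]|_ [p _ <-]].
  have [||p fp] := @raw_surj J K f.
  - by move=> jk; have /= := f0 jk; rewrite in_itv/= => /andP[].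
  - by move=> j; exact: f1.
  - by exists p.
split=> [i|j _] /=; last exact: (dist_sum1 (p j)).
by rewrite in_itv/= dist_ge0 dist_le1.
Qed.

End Attained.

Section Mixtures.
Context {R : realType} {n : nat} {A : 'I_n -> finType}.
Local Notation I := (context n * outputs A)%type.
Local Notation W := ({ptws I -> R} : topologicalType).
Local Notation behaviour := (behaviour R A).

Lemma mixture_exists (s : R) (p' p'' : behaviour) :
  0 <= s <= 1 -> exists p, is_mixture s p p' p''.
Proof.
move=> /andP[s0 s1].
have [||p pE] := @raw_surj R _ _ (fun i : I => s * raw p' i + (1 - s) * raw p'' i).
- by move=> i; rewrite addr_ge0// mulr_ge0 ?dist_ge0 ?subr_ge0.
- move=> x; have sum1 (q : behaviour) : \sum_a raw q (x, a) = 1.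
    exact: (dist_sum1 (q x)).
  by rewrite big_split/= -!mulr_sumr !sum1 !mulr1 addrC subrK.
- by exists p => x a; exact: (congr1 (fun f => f (x, a)) pE).
Qed.

(* P is presented as the image of a compact set under a continuous map. *)
Variables (T : topologicalType) (Th : set T) (phi : T -> I -> R).
Variable P : behaviour -> Prop.
Hypothesis Th_compact : compact Th.
Hypothesis phi_cont : forall i, continuous (phi^~ i).
Hypothesis P_Th : forall p, P p -> exists2 t, Th t & phi t = raw p.
Hypothesis Th_P : forall t, Th t -> exists2 p, P p & phi t = raw p.

Let K : set (R * T * W) := `[0, 1]%classic `*` Th `*` range (@raw R _ _).

Let K_compact : compact K.
Proof.
apply: compact_setX; last exact: raw_compact.
by apply: compact_setX => //; exact: segment_compact.
Qed.

Let m (k : R * T * W) (i : I) : R :=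
  k.1.1 * phi k.1.2 i + (1 - k.1.1) * k.2 i.

Let w_cont : continuous (fun k : R * T * W => k.1.1).
Proof.
by move=> k; apply: continuous_comp; exact: continuous_fst.
Qed.

Let m_cont i : continuous (m^~ i).
Proof.
have phi_c : continuous (fun k : R * T * W => phi k.1.2 i).
  move=> k; apply: (@continuous_comp _ _ _ (fun k : R * T * W => k.1.2) (phi^~ i)).
    by apply: continuous_comp; [exact: continuous_fst|exact: continuous_snd].
  exact: phi_cont.
have sndc : continuous (fun k : R * T * W => k.2 i).
  move=> k; apply: (@continuous_comp _ _ _ (fun k : R * T * W => k.2) (fun f : W => f i : R)).
    exact: continuous_snd.
  exact: coord_cont.
apply: continuous_add; apply: continuous_mul => //.
by apply: continuous_sub => //; exact: cst_continuous.
Qed.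

Let weightsP p s : weights P p s <-> exists2 k, K k & k.1.1 = s /\ m k = raw p.
Proof.
split=> [[s01 [p' [p'' [Pp' mix]]]]|].
  have [t Tht tp'] := P_Th Pp'.
  exists (s, t, raw p'') => /=.
    by split; [split => //=; rewrite in_itv|exists p''].
  split=> //; apply/funext => -[x a].
  by rewrite /m/= tp' /raw/= mix.
move=> [[[s' t] f] [[/= + Tht] [p'' _ /= fE]] [/= ss mp]].
subst f s'.
rewrite in_itv/= => s01; split => //.
have [p' Pp' tp'] := Th_P Tht; exists p', p''; split => // x a.
have := congr1 (fun f => f (x, a)) mp.
by rewrite /m/= tp' /raw/= => <-.
Qed.

Lemma weights_max p : weights P p !=set0 ->
  is_max (weights P p) (sup (weights P p)).
Proof.
move=> [s0 /weightsP[k0 Kk0 [_ k0p]]].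
pose F : set (R * T * W) := \bigcap_(i in setT) [set k | m k i = raw p i].
have cF : closed F.
  apply: closed_bigI => i _.
  apply: (@closed_fun_eq _ _ (m^~ i) (fun=> raw p i)); first exact: m_cont.
  exact: cst_continuous.
have FP k : F k <-> m k = raw p.
  split=> [Fk|kp i _ /=]; last by rewrite kp.
  by apply/funext => i; exact: (Fk i).
have [||c] := @compact_EVT_max _ R (fun k => k.1.1) (K `&` F) _
    (compact_closedI K_compact cF).
- by exists k0; split => //; exact/FP.
- exact/continuous_subspaceT/w_cont.
rewrite inE => -[Kc /FP cp] cmax; apply: (@is_max_sup _ _ c.1.1); split.
  by apply/weightsP; exists c.
move=> s /weightsP[k Kk [<- kp]]; apply: cmax; rewrite inE; split => //.
exact/FP.
Qed.

Lemma scores_max (G : game R A) (sigma : R) (D : (I -> R) -> Prop) :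
  (forall (T' : topologicalType) (h : T' -> I -> R),
    (forall i, continuous (h^~ i)) -> closed [set t | D (h t)]) ->
  (forall p, weights P p !=set0) ->
  (exists2 p, 1 - sup (weights P p) <= sigma & D (raw p)) ->
  let E := [set score G p | p in
    [set p | 1 - sup (weights P p) <= sigma /\ D (raw p)]] in
  is_max E (sup E).
Proof.
move=> Dcl w0 [p0 p0s Dp0] E.
pose F : set (R * T * W) := [set k | 1 - sigma <= k.1.1] `&` [set k | D (m k)].
have cF : closed F by apply: closedI; [exact: closed_fun_ge|exact: Dcl].
pose S k := \sum_x \sum_a game_dist G x * (game_rule G a x)%:R * m k (x, a).
have S_cont : continuous S.
  apply: continuous_sum => x; apply: continuous_sum => a.
  by apply: continuous_mul; [exact: cst_continuous|exact: m_cont].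
have good p : 1 - sup (weights P p) <= sigma -> D (raw p) ->
    exists2 k, (K `&` F) k & S k = score G p.
  move=> ps Dp; have [/weightsP[k Kk [ks kp]] _] := weights_max (w0 p).
  exists k; last by rewrite /S kp.
  by split => //; split => /=; [rewrite ks; lra|rewrite kp].
have [||c] := @compact_EVT_max _ R S (K `&` F) _ (compact_closedI K_compact cF).
- by have [k Kk _] := good p0 p0s Dp0; exists k.
- exact/continuous_subspaceT/S_cont.
rewrite inE => -[Kc [/= cs cD]] cmax; apply: (@is_max_sup _ _ (S c)); split.
  have [p mp] : exists p, m c = raw p.
    case: {cs cD cmax} c Kc => -[s t] _ /= [[/= s01 Tht] [p'' _ <-]].
    have [p' Pp' tp'] := Th_P Tht.
    have [|p pE] := @mixture_exists s p' p''; first by rewrite in_itv in s01.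
    by exists p; apply/funext => -[x a]; rewrite /m/= tp' /raw/= pE.
  have wc : weights P p c.1.1 by apply/weightsP; exists c.
  exists p; last by rewrite /S mp.
  split; last by rewrite -mp.
  have := (weights_max (w0 p)).2 _ wc; lra.
by move=> _ [p [ps Dp] <-]; have [k Kk <-] := good p ps Dp; apply: cmax; rewrite inE.
Qed.

End Mixtures.

Section Maxima.
Context {R : realType} {n : nat} {A : 'I_n -> finType}.
Hypothesis A_gt0 : forall i, (0 < #|A i|)%N.
Local Notation I := (context n * outputs A)%type.
Local Notation W := ({ptws I -> R} : topologicalType).
Local Notation behaviour := (behaviour R A).
Implicit Types (G : game R A) (p : behaviour) (C : context n).

Let NS : set W := range (@raw R _ _) `&`
  [set f | forall (x x' : context n) (J : {set 'I_n}),
    (forall i, i \in J -> x i = x' i) -> forall b : outputs A,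
    \sum_(a : outputs A | [forall i in J, a i == b i]) f (x, a) =
    \sum_(a : outputs A | [forall i in J, a i == b i]) f (x', a)].

Let NS_compact : compact NS.
Proof.
apply: compact_closedI; first exact: raw_compact.
pose Z := (context n * context n * {set 'I_n} * outputs A)%type.
pose D : set Z := [set z : Z | forall i : 'I_n, i \in z.1.2 -> z.1.1.1 i = z.1.1.2 i].
pose F (z : Z) : set W := [set f |
  \sum_(a : outputs A | [forall i in z.1.2, a i == z.2 i]) f (z.1.1.1, a) =
  \sum_(a : outputs A | [forall i in z.1.2, a i == z.2 i]) f (z.1.1.2, a)].
have cF : closed (\bigcap_(z in D) F z).
  apply: closed_bigI => z _; apply: closed_fun_eq;
    by apply: continuous_sum => a; exact: coord_cont.
congr (closed _): cF; apply/seteqP; split=> f /= h.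
  by move=> x x' J xx' b; exact: (h (x, x', J, b)).
by move=> [[[x x'] J] b] xx'; exact: h.
Qed.

Let NS_P p : no_signalling p -> exists2 f : W, NS f & (f : I -> R) = raw p.
Proof. by move=> nsp; exists (raw p). Qed.

Let P_NS (f : W) : NS f -> exists2 p, no_signalling p & (f : I -> R) = raw p.
Proof. by move=> [[p _ <-] ns]; exists p. Qed.

Let V : topologicalType := {ptws unit * assignment A -> R}.
Let push (f : V) (i : I) : R := \sum_(g | answers g i.1 == i.2) f (tt, g).

Let push_cont i : continuous (push^~ i).
Proof. by apply: continuous_sum => g; exact: coord_cont. Qed.

Let NC : set V := range (@raw R unit (assignment A)).

Let NC_P p : non_contextual p -> exists2 f, NC f & push f = raw p.
Proof.
move=> [d pd]; exists (raw (fun=> d)); first by exists (fun=> d).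
by apply/funext => -[x a]; rewrite /push /raw /= pd.
Qed.

Let P_NC f : NC f -> exists2 p, non_contextual p & push f = raw p.
Proof.
move=> [d _ <-].
have [||p pE] := @raw_surj R _ _ (push (raw d)).
- by move=> i; apply: sumr_ge0 => g _; exact: dist_ge0.
- move=> x; rewrite -[RHS](dist_sum1 (d tt)).
  rewrite [RHS](partition_big (fun g => answers g x) xpredT)//=.
- exists p => //; exists (d tt) => x a.
  exact: (congr1 (fun f => f (x, a)) pE).
Qed.

Let det_exists : exists p : behaviour,
  [/\ no_signalling p, non_contextual p & forall C, exists a, p C a = 1].
Proof.
have [g0 _] : exists g0 : assignment A, True.
  have [g _] := @fin_all_exists _ (fun it : 'I_n * bool => A it.1)
    (fun _ _ => True) (fun it => let: ex_intro a _ := card_gt0P (A_gt0 it.1) in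
      ex_intro _ a Logic.I).
  by exists (finfun g).
have delta_sum (K : finType) (c : K) : \sum_k (k == c)%:R = 1 :> R.
  by rewrite (bigD1 c)//= eqxx big1 ?addr0// => k /negbTE ->.
have [||p pE] := @raw_surj R _ _
    (fun i : context n * outputs A => (i.2 == answers g0 i.1)%:R).
- by move=> i; exact: ler0n.
- by move=> x; exact: (delta_sum _ (answers g0 x)).
have {}pE x a : p x a = (a == answers g0 x)%:R.
  exact: (congr1 (fun f => f (x, a)) pE).
have [||d dE] := @raw_surj R unit _
    (fun i : unit * assignment A => (i.2 == g0)%:R).
- by move=> i; exact: ler0n.
- by move=> x; exact: (delta_sum _ g0).
have {}dE g : d tt g = (g == g0)%:R.
  exact: (congr1 (fun f => f (tt, g)) dE).
have sumE (K : finType) (Q : pred K) (c : K) :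
    \sum_(k | Q k) (k == c)%:R = (Q c)%:R :> R.
  case: (boolP (Q c)) => Qc; first by
    rewrite (bigD1 c)//= eqxx big1 ?addr0// => k /andP[_ /negbTE ->].
  by rewrite big1// => k Qk; case: eqP Qk Qc => // -> ->.
exists p; split; last by move=> C; exists (answers g0 C); rewrite pE eqxx.
- move=> x x' J xx' b; rewrite /marginal.
  under eq_bigr do rewrite pE; under [RHS]eq_bigr do rewrite pE.
  rewrite !sumE; congr (_%:R); congr nat_of_bool.
  apply/eq_forallb => i; case: (boolP (i \in J)) => //= iJ.
  by rewrite !ffunE xx'.
- exists (d tt) => x a; rewrite pE.
  under eq_bigr do rewrite dE.
  by rewrite sumE eq_sym.
Qed.

Let one_weight (P : behaviour -> Prop) p : P p -> weights P p 1.
Proof.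
move=> Pp; split; first by rewrite ler01 lexx.
by exists p, p; split => // x a; rewrite mul1r subrr mul0r addr0.
Qed.

Let zero_weight (P : behaviour -> Prop) p : (exists p', P p') -> weights P p 0.
Proof.
move=> [p' Pp']; split; first by rewrite lexx ler01.
by exists p', p; split => // x a; rewrite mul0r subr0 mul1r add0r.
Qed.

Let ns_weights p : weights no_signalling p !=set0.
Proof. by exists 0; apply: zero_weight; have [p' []] := det_exists; exists p'. Qed.

Let nc_weights p : weights non_contextual p !=set0.
Proof. by exists 0; apply: zero_weight; have [p' []] := det_exists; exists p'. Qed.

Let id_cont (i : context n * outputs A) : continuous (fun f : W => f i : R).
Proof. exact: coord_cont. Qed.

Lemma signalling_fraction_max p :
  is_max (weights no_signalling p) (1 - signalling_fraction p).
Proof.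
rewrite /signalling_fraction subKr.
exact: (weights_max NS_compact id_cont NS_P P_NS).
Qed.

Lemma contextual_fraction_max p :
  is_max (weights non_contextual p) (1 - contextual_fraction p).
Proof.
rewrite /contextual_fraction subKr.
exact: (weights_max (@raw_compact R _ _) push_cont NC_P P_NC).
Qed.

Lemma det_score_max G C sigma : 0 <= sigma ->
  is_max (det_scores G C sigma) (det_score G C sigma).
Proof.
move=> s0.
pose D (f : context n * outputs A -> R) := exists a, f (C, a) = 1.
apply: (@scores_max _ _ _ _ _ _ _ NS_compact id_cont NS_P P_NS G sigma D) => //.
  move=> T' h hc.
  have -> : [set t | D (h t)] =
      \bigcup_(a in [set: outputs A]) [set t | h t (C, a) = 1].
    by apply/seteqP; split => t /= [a]; [exists a|move=> _ ?; exists a].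
  apply: closed_bigcup => [|a _]; first exact: finite_finset.
  apply: closed_fun_eq; first exact: hc.
  exact: cst_continuous.
have [p [nsp _ /(_ C) Dp]] := det_exists; exists p => //.
have := (signalling_fraction_max p).2 _ (one_weight nsp).
by rewrite /signalling_fraction; lra.
Qed.

Lemma cl_score_max G xi : 0 <= xi ->
  is_max (cl_scores G xi) (cl_score G xi).
Proof.
move=> s0; rewrite /cl_score.
have -> : cl_scores G xi = [set score G p | p in
    [set p | 1 - sup (weights non_contextual p) <= xi /\ True]].
  by apply/seteqP; split=> _ [p /= h <-]; exists p => //=; case: h.
apply: (@scores_max _ _ _ _ _ _ _ (@raw_compact R _ _) push_cont NC_P P_NC
    G xi (fun=> True)) => //.
have [p [_ ncp _]] := det_exists; exists p => //.
have := (contextual_fraction_max p).2 _ (one_weight ncp).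
by rewrite /contextual_fraction; lra.
Qed.

End Maxima.

(* Main.v *)
Require Import Defs.
From mathcomp Require Import all_boot all_order all_algebra.
From mathcomp Require Import lra.
From mathcomp Require Import all_classical all_reals all_analysis.

(** If a behaviour with a deterministic output tuple [a] at [C] has a
    no-signalling part of positive weight, that part also outputs [a] at [C].
    By no-signalling, in every context [x] each player [i] with [x i = C i]
    outputs [a i], so the outputs at [x] are determined by the marginal on the
    other players, all of whose inputs are opposite to those of [C]; this
    marginal is that of the single distribution at the context opposite to [C].
    Hence answering [a i] to [C i], and to the other input according to that
    distribution, is a random global assignment giving the no-signalling part. *)

Import Order.TTheory GRing.Theory Num.Theory.

Local Open Scope ring_scope.

Section Dist.
Context {R : realType}.

Lemma dist_eq0_notin {T : finType} (q : dist R T) (P : pred T) t :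
  \sum_(u | P u) q u = 1 -> ~~ P t -> q t = 0.
Proof.
move=> q1; apply: (@psumr_eq0P _ _ [pred u | ~~ P u]) => [u _|].
  exact: dist_ge0.
by have := dist_sum1 q; rewrite (bigID P)/= q1; lra.
Qed.

Lemma dist_sum_eq1 {T : finType} (q : dist R T) (P : pred T) t :
  q t = 1 -> P t -> \sum_(u | P u) q u = 1.
Proof.
move=> qt Pt; apply/eqP; rewrite eq_le; apply/andP; split.
  rewrite -[leRHS](dist_sum1 q) [leRHS](bigID P)/= lerDl.
  by apply: sumr_ge0 => u _; exact: dist_ge0.
rewrite (bigD1 t)//= qt lerDl.
by apply: sumr_ge0 => u _; exact: dist_ge0.
Qed.

(** This is the pushforward of [q] along [f], stated on events so that it applies directly to
    [answers _ x == c]. *)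
Lemma dist_map_exists {S T : finType} (f : S -> T) (q : dist R S) :
  exists d : dist R T,
    forall P : pred T, \sum_(t | P t) d t = \sum_(s | P (f s)) q s.
Proof.
have sumE (P : pred T) :
    \sum_(t | P t) \sum_(s | f s == t) q s = \sum_(s | P (f s)) q s.
  rewrite [RHS](partition_big f P)//=; apply: eq_bigr => t Pt.
  by apply: eq_bigl => s; case: eqP => [->|]; rewrite ?Pt ?andbF.
have d0 t : 0 <= \sum_(s | f s == t) q s.
  by apply: sumr_ge0 => s _; exact: dist_ge0.
exists (Dist d0 (etrans (sumE xpredT) (dist_sum1 q))) => P.
exact: sumE.
Qed.

Lemma mixture_eq1 (s u v : R) :
  0 < s -> s <= 1 -> u <= 1 -> v <= 1 -> s * u + (1 - s) * v = 1 -> u = 1.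
Proof. by move=> *; nra. Qed.

End Dist.

Section Determinism.
Context {R : realType} {n : nat} {A : 'I_n -> finType}.

Lemma no_signalling_det_non_contextual (p : behaviour R A) C a :
  no_signalling p -> p C a = 1 -> non_contextual p.
Proof.
move=> nsp pCa.
pose I (x : context n) : {set 'I_n} := [set i | x i == C i].
have agree x (b : outputs A) : ~~ [forall i in I x, b i == a i] -> p x b = 0.
  apply: (@dist_eq0_notin _ _ _
    (fun b : outputs A => [forall i in I x, b i == a i])).
  have xC i : i \in I x -> x i = C i by rewrite inE => /eqP.
  have := nsp x C (I x) xC a; rewrite /marginal => ->.
  by apply: dist_sum_eq1 pCa _; apply/forall_inP.
pose F (b : outputs A) : assignment A :=
  [ffun it => if it.2 == C it.1 then a it.1 else b it.1].
pose Cc : context n := [ffun i => ~~ C i].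
have [d dE] := dist_map_exists F (p Cc); exists d => x c; rewrite dE.
have answersE (b : outputs A) i :
    answers (F b) x i = if x i == C i then a i else b i.
  by rewrite !ffunE.
(* If [c] differs from [a] somewhere on [I x], both sides vanish: no [F b] answers [c] at [x]. *)
have [ca|ca] := boolP [forall i in I x, c i == a i]; last first.
  rewrite agree// big1// => b /eqP Fbc; case/negP: ca.
  apply/forall_inP => i; rewrite inE => xC.
  by rewrite -Fbc answersE xC.
(* Inputs are binary, so an input different from that of [C] is the one in [Cc]. *)
have xCc i : i \in ~: I x -> x i = Cc i.
  by rewrite !inE !ffunE; case: (x i); case: (C i).
have := nsp x Cc (~: I x) xCc c; rewrite /marginal => mE.
(* By [agree], only [c] can carry mass in this event. *)
have -> : p x c = \sum_(b : outputs A | [forall i in ~: I x, b i == c i]) p x b.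
  rewrite (bigD1 c)/= ?big1 ?addr0//; last by apply/forall_inP.
  move=> b /andP[bc bNc]; apply: agree; apply: contraNN bNc => ba.
  apply/eqP/ffunP => i; have [iI|iNI] := boolP (i \in I x).
    by rewrite (eqP (forall_inP ba i iI)) (eqP (forall_inP ca i iI)).
  by apply/eqP/(forall_inP bc); rewrite inE.
rewrite mE; apply: eq_bigl => b; apply/forall_inP/eqP => [bc|Fbc i].
  apply/ffunP => i; rewrite answersE; case: ifPn => xC.
    by apply/esym/eqP/(forall_inP ca); rewrite inE.
  by apply/eqP/bc; rewrite !inE.
by rewrite !inE -Fbc answersE => /negbTE ->.
Qed.

(** An optimal no-signalling decomposition of positive weight has a non-contextual first part, since
    that part inherits the certainty of [a] at [C]. *)
Lemma det_contextual_fraction_le (p : behaviour R A) C a :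
  (forall i, (0 < #|A i|)%N) -> p C a = 1 ->
  contextual_fraction p <= signalling_fraction p.
Proof.
move=> A0 pCa.
have [[s01 [p' [p'' [nsp' mix]]]] _] := signalling_fraction_max A0 p.
have [[/andP[c0 _] _] cmax] := contextual_fraction_max A0 p.
set s := 1 - signalling_fraction p in s01 mix.
suff : s <= 1 - contextual_fraction p by rewrite /s; lra.
(* At weight 0 nothing is known about [p'], but the bound is just [c0]. *)
have /andP[s0 s1] := s01; have [->//|sn0] := eqVneq s 0.
apply: cmax; split=> //; exists p', p''; split=> //.
apply: (@no_signalling_det_non_contextual _ C a nsp').
have sgt0 : 0 < s by rewrite lt_def sn0.
apply: (mixture_eq1 _ _ (p'' C a) sgt0 s1); rewrite ?dist_le1//.
by rewrite -mix.
Qed.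

End Determinism.

Theorem proposition3 (R : realType) (n : nat) (A : 'I_n -> finType)
    (G : game R A) (C : context n) (sigma : R)
    (n_ge1 : (1 <= n)%N)
    (A_nonempty : forall i : 'I_n, (0 < #|A i|)%N)
    (sigma01 : 0 <= sigma <= 1) :
  det_score G C sigma <= cl_score G sigma.
Proof.
have /andP[s0 _] := sigma01.
have [[p [psigma [a pCa]] <-] _] := det_score_max A_nonempty G C s0.
have [_ clmax] := cl_score_max A_nonempty G s0.
apply: clmax; exists p => //=.
exact: le_trans (det_contextual_fraction_le _ _ _ A_nonempty pCa) psigma.
Qed.
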